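(* Let $S$ be a subset of the symmetric group $S_4$ which contains the identity permutation $id$. If $S \neq \{id\}$, then $S$ is bad; that is, there exists a planar graph $G$ that is not $S$-$4$-colourable.
   Context: Graphs are finite and simple. $[k]=\{1,2,\ldots,k\}$, $S_k$ denotes the symmetric group of all permutations of $[k]$, and $id$ denotes the identity permutation. Let $S$ be a non-empty subset of $S_k$. An $S$-labeling of a graph $G$ is a pair $(D,\sigma)$, where $D$ is an orientation of $G$ (each edge of $G$ is given exactly one of its two directions) and $\sigma: E(D)\to S$ is a mapping which assigns to each arc $e=(x,y)$ of $D$ a permutation $\sigma_e\in S$. A proper $k$-colouring of $(D,\sigma)$ is a mapping $f: V(G)\to [k]$ such that $\sigma_e(f(x))\neq f(y)$ for each arc $e=(x,y)$ of $D$. The graph $G$ is $S$-$k$-colourable if every $S$-labeling $(D,\sigma)$ of $G$ has a proper $k$-colouring. A non-empty subset $S$ of $S_4$ is called good if every planar graph is $S$-$4$-colourable, and bad otherwise. *)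

(* Defs.v *)
From HB Require Import structures.
From mathcomp Require Import all_boot all_order all_algebra all_fingroup.
From mathcomp Require Import all_classical all_reals all_analysis.

Set Implicit Arguments.
Unset Strict Implicit.
Unset Printing Implicit Defensive.

Import Order.TTheory GRing.Theory Num.Theory.
Import numFieldNormedType.Exports.

Local Open Scope ring_scope.
Local Open Scope classical_set_scope.

Record sgraph := SGraph {
  vertex :> finType;
  edge : rel vertex;
  edge_sym : symmetric edge;
  edge_irr : irreflexive edge }.

Definition is_arc (R : realType) (A : set (R * R)) (a b : R * R) : Prop :=
  exists gamma : R -> R * R,
    [/\ {within `[0, 1], continuous gamma},
        {in `[0, 1] &, injective gamma},
        gamma 0 = a,
        gamma 1 = b &
        A = gamma @` `[0, 1]].

(* The relation [edge] contains both (x, y) and (y, x), which name the same edge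
   and so carry the same arc.  By the fourth clause, the common points allowed
   by the fifth can only be drawings of common ends of the two edges. *)
Definition planar_drawing (R : realType) (G : sgraph)
    (p : G -> R * R) (A : G -> G -> set (R * R)) : Prop :=
  [/\ injective p,
      forall x y : G, edge x y -> A x y = A y x,
      forall x y : G, edge x y -> is_arc (A x y) (p x) (p y),
      forall x y z : G, edge x y -> A x y (p z) -> z = x \/ z = y &
      forall x y u v : G, edge x y -> edge u v ->
        (x, y) <> (u, v) -> (x, y) <> (v, u) ->
        A x y `&` A u v `<=` range p].

Definition planar (R : realType) (G : sgraph) : Prop :=
  exists (p : G -> R * R) (A : G -> G -> set (R * R)), planar_drawing p A.

Definition is_orientation (G : sgraph) (D : rel G) : Prop :=
  (forall x y : G, D x y -> edge x y) /\
  (forall x y : G, edge x y -> D x y (+) D y x).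

(* The colour set {1, ..., k} is encoded as 'I_k.  The values of [sigma] off
   the arcs of [D] are irrelevant. *)
Definition is_labeling (k : nat) (S : {set 'S_k}) (G : sgraph)
    (D : rel G) (sigma : G -> G -> 'S_k) : Prop :=
  is_orientation D /\ (forall x y : G, D x y -> sigma x y \in S).

Definition proper_colouring (k : nat) (G : sgraph)
    (D : rel G) (sigma : G -> G -> 'S_k) (f : G -> 'I_k) : Prop :=
  forall x y : G, D x y -> sigma x y (f x) <> f y.

Definition colourable (k : nat) (S : {set 'S_k}) (G : sgraph) : Prop :=
  forall (D : rel G) (sigma : G -> G -> 'S_k),
    is_labeling S D sigma ->
    exists f : G -> 'I_k, proper_colouring D sigma f.

(* [R] is any model of the real numbers; it only serves to form the plane. *)
Definition good (R : realType) (S : {set 'S_4}) : Prop :=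
  S <> finset.set0 /\ forall G : sgraph, planar R G -> colourable S G.

Definition bad (R : realType) (S : {set 'S_4}) : Prop :=
  S <> finset.set0 /\ ~ good R S.

(* Main.v *)
Require Import Defs.
From Stdlib Require Import BinInt Pnat.
From mathcomp Require Import all_boot all_order all_algebra all_fingroup.
From mathcomp Require Import all_classical all_reals all_analysis.
From mathcomp Require Import ssrZ ring lra.

(** Choose [sg] in [S] other than the identity.  Renaming colours turns a proper
    colouring for labels in [{1, sg}] into one for labels in [{1, sg'}] for any
    conjugate [sg'] of [sg], so [sg] may be taken to be (0 1), (0 1)(2 3),
    (0 1 2) or (0 1 2 3) ([normal_form]), with colours 0, 1, 2, 3.

    The counterexamples have a common frame: a triangulation on seven vertices
    obtained from a triangle by repeatedly putting a new vertex into a face, all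
    of whose edges carry the identity.  Its proper 4-colouring is unique up to
    renaming the colours, and different faces see different triples of colours
    in different cyclic orders.  Some faces are filled with a copy of a labelled
    plane gadget, and a gadget blocks certain triples: no colouring of its inner
    vertices extends these colours of its three corners.  The slots are chosen
    such that each of the 24 colourings of the frame puts a blocked triple on
    the corners of at least one gadget.

    The gadgets rest on the octahedron.  If its three inner vertices are left
    with the same two colours by the corners, and the inner edges identify these
    2-element lists consistently around the inner triangle, then there is no
    colouring, since a triangle is not 2-colourable.
    - For (0 1 2), corners 0, 1, 2 and identity labels towards them leave the
      lists {2,3}, {0,3}, {1,3}, which the cyclically oriented inner triangle
      carries onto each other.
    - For (0 1 2 3), corners 0, 1, 2 leave the lists {2,3}, {0,3}, {0,3}, the
      third because one of its labels turns the corner colour 0 into 1, and the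
      inner edges again identify the lists.
    - For (0 1) and (0 1)(2 3), the colours split into the halves {0,1} and
      {2,3}.  Once the labels towards the corners are suited to the labels of
      the outer edges, an octahedron forbids that its three corners all have
      colours in {0,1}: its inner vertices would be left with {2,3}.  For
      (0 1)(2 3), where the halves play the same part, it also forbids that
      they all have colours in {2,3}.  The gadget used for both permutations is
      a triangulation with nine inner vertices, two faces of which are filled
      with octahedra in this way.  If two corners have colours in {0,1} and the
      third has not, then however the nine vertices are split between the
      halves, one of the two faces gets all its colours in one half, or some
      cycle inside a half has no proper colouring with the two colours of this
      half.

    That the gadgets block the listed triples, and that every colouring of the
    frame meets a blocked triple, is found by searching through all colourings
    ([uncolourableP]).

    For planarity, all edges are drawn as straight segments between integer
    points.  Two segments without a common end are disjoint as soon as the line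
    through one of them has both ends of the other strictly on one side
    ([segments_disjoint]), and two segments from a common end meet only there
    unless they are collinear ([segments_fan]).  These are sign conditions on
    integer determinants ([straight_line_planar]). *)

Set Implicit Arguments.
Unset Strict Implicit.
Unset Printing Implicit Defensive.

Import Order.TTheory GRing.Theory Num.Theory.
Import numFieldNormedType.Exports.

Delimit Scope Z_scope with binZ.

Local Open Scope ring_scope.
Local Open Scope classical_set_scope.

(** * Straight segments in the plane *)

Definition line (R : realType) (a b : R * R) (t : R) : R * R :=
  (a.1 + t * (b.1 - a.1), a.2 + t * (b.2 - a.2)).

Definition segment (R : realType) (a b : R * R) : set (R * R) :=
  line a b @` `[0, 1].

Lemma segment_is_arc (R : realType) (a b : R * R) :
  a <> b -> is_arc (segment a b) a b.
Proof.
move=> ab; exists (line a b); split.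
- have affine (c d : R) : continuous (fun t : R => c + t * d).
    by move=> t; apply: cvgD; [exact: cvg_cst|apply: cvgMr_tmp; exact: cvg_id].
  apply: continuous_subspaceT => t.
  exact: (cvg_pair (affine _ _ t) (affine _ _ t)).
- move=> s t _ _ [] /addrI h1 /addrI h2; apply/eqP/negPn/negP => st.
  have collapse (c d : R) : s * (d - c) = t * (d - c) -> c = d.
    move/eqP; rewrite -subr_eq0 -mulrBl mulf_eq0 subr_eq0 (negbTE st) /=.
    by rewrite subr_eq0 => /eqP.
  apply: ab; case: a b h1 h2 => [a1 a2] [b1 b2] /= h1 h2.
  by rewrite (collapse _ _ h1) (collapse _ _ h2).
- by rewrite /line !mul0r !addr0; case: (a).
- by case: (b) => b1 b2; rewrite /line; congr pair => /=; ring.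
- by [].
Qed.

Lemma segmentC (R : realType) (p q : R * R) : segment p q = segment q p.
Proof.
suff sub (a b : R * R) : segment a b `<=` segment b a by apply/seteqP.
move=> w [t /=]; rewrite in_itv /= => /andP[t0 t1] <-; exists (1 - t).
  by rewrite /= in_itv /=; lra.
by rewrite /line; congr pair; ring.
Qed.

(** Twice the signed area of the triangle [p q r]: its sign tells on which side
    of the line [p q] the point [r] lies. *)
Definition orientation (A : pzRingType) (p q r : A * A) : A :=
  (q.1 - p.1) * (r.2 - p.2) - (q.2 - p.2) * (r.1 - p.1).

Lemma orientation_segment (R : realType) (p q w : R * R) :
  segment p q w -> orientation p q w = 0.
Proof. by move=> [t _ <-]; rewrite /orientation /line /=; ring. Qed.

(** The orientation with respect to [p q] is affine along [u v], so it cannot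
    vanish there when its values at both ends have the same sign. *)
Lemma segments_disjoint (R : realType) (p q u v w : R * R) :
  0 < orientation p q u * orientation p q v ->
  segment p q w -> segment u v w -> False.
Proof.
move=> side /orientation_segment pqw [t /=].
rewrite in_itv /= => /andP[t0 t1] wE.
have : (1 - t) * orientation p q u + t * orientation p q v = 0.
  by rewrite -pqw -wE /orientation /line /=; ring.
move: side; set a := orientation p q u; set b := orientation p q v => side h.
have : (1 - t) * a * a + t * (a * b) = 0 by rewrite -(mulr0 a) -h; ring.
have : a * a > 0.
  have a0 : a != 0 by apply/eqP => a0; move: side; rewrite a0 mul0r ltxx.
  by rewrite -expr2 exprn_even_gt0.
case: (eqVneq t 0) => [->|tN0] a2 h2; first by lra.
have t_gt0 : 0 < t by rewrite lt_neqAle eq_sym tN0.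
have := mulr_gt0 t_gt0 side; have : 0 <= (1 - t) * a * a.
  by rewrite -mulrA mulr_ge0 ?subr_ge0 ?(ltW a2).
lra.
Qed.

Lemma segments_fan (R : realType) (p q v w : R * R) :
  orientation p q v != 0 -> segment p q w -> segment p v w -> w = p.
Proof.
move=> pqv /orientation_segment pqw [t _ wE].
have : t * orientation p q v = 0.
  by rewrite -pqw -wE /orientation /line /=; ring.
move/eqP; rewrite mulf_eq0 (negbTE pqv) orbF => /eqP t0.
by rewrite -wE t0 /line !mul0r !addr0; case: (p).
Qed.

Definition real_of_Z (R : realType) (z : Z) : R := (int_of_Z z)%:~R.

Definition plane_point (R : realType) (z : Z * Z) : R * R :=
  (real_of_Z R z.1, real_of_Z R z.2).

Lemma real_of_Z_inj (R : realType) : injective (real_of_Z R).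
Proof.
by move=> x y /eqP; rewrite eqr_int => /eqP /(can_inj int_of_ZK).
Qed.

Lemma real_of_Z_gt0 (R : realType) (z : Z) :
  (0 <? z)%binZ -> 0 < real_of_Z R z.
Proof.
case: z => // p _; rewrite /real_of_Z /= ltr0z.
by rewrite ltz_nat; apply/ssrnat.ltP; exact: Pos2Nat.is_pos.
Qed.

Lemma orientation_plane_point (R : realType) (p q r : Z * Z) :
  orientation (plane_point R p) (plane_point R q) (plane_point R r) =
  real_of_Z R (orientation p q r).
Proof. by rewrite /real_of_Z /orientation /= !(rmorphB, rmorphM). Qed.

(** * Graphs given by lists of labelled arcs *)

(** An arc carries the distinguished permutation if its boolean is [true], and
    the identity otherwise. *)
Definition arc := (nat * nat * bool)%type.

Definition arc_rel (n : nat) (A : seq arc) : rel 'I_n :=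
  fun x y => (val x, val y) \in map fst A.

Definition arc_edge (n : nat) (A : seq arc) : rel 'I_n :=
  fun x y => (x != y) && (arc_rel A x y || arc_rel A y x).

Lemma arc_edge_sym (n : nat) (A : seq arc) : symmetric (@arc_edge n A).
Proof. by move=> x y; rewrite /arc_edge eq_sym orbC. Qed.

Lemma arc_edge_irr (n : nat) (A : seq arc) : irreflexive (@arc_edge n A).
Proof. by move=> x; rewrite /arc_edge eqxx. Qed.

Definition arc_graph (n : nat) (A : seq arc) : sgraph :=
  SGraph (@arc_edge_sym n A) (@arc_edge_irr n A).

(** No loops, parallel arcs or antiparallel arcs: a loop is its own reversal. *)
Definition simple_arcs (A : seq arc) : bool :=
  uniq (map fst A) && all (fun a => (a.1.2, a.1.1) \notin map fst A) A.

(** * Planarity of straight-line drawings *)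

Definition separated (p q u v : Z * Z) : bool :=
  (0 <? orientation p q u * orientation p q v)%binZ.

(** Nested conditionals instead of a disjunction keep the evaluation short: the
    two tests by determinants settle all pairs without a common end. *)
Definition clear_of (pts : seq (Z * Z)) (e f : nat * nat) : bool :=
  let pt := nth (0, 0)%binZ pts in
  if separated (pt e.1) (pt e.2) (pt f.1) (pt f.2) then true
  else if separated (pt f.1) (pt f.2) (pt e.1) (pt e.2) then true
  else [|| e.1 == f.1, e.1 == f.2, e.2 == f.1 | e.2 == f.2].

(** Requiring that [z] is off the whole line, and not only off the segment,
    also prevents edges with a common end from overlapping. *)
Definition off_line (pts : seq (Z * Z)) (e : nat * nat) (z : nat) : bool :=
  let pt := nth (0, 0)%binZ pts in
  [|| z == e.1, z == e.2 |
      ~~ (orientation (pt e.1) (pt e.2) (pt z) =? 0)%binZ].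

Definition drawing_ok (pts : seq (Z * Z)) (es : seq (nat * nat)) : bool :=
  [&& uniq pts, all (fun e => all (off_line pts e) (iota 0 (size pts))) es &
      pairwise (clear_of pts) es].

Lemma pairwise_or (T : eqType) (r : rel T) (s : seq T) (x y : T) :
  pairwise r s -> x \in s -> y \in s -> x != y -> r x y || r y x.
Proof.
elim: s => // z s IHs /= /andP[/allP zs rs]; rewrite !inE.
case/predU1P=> [->|xs] /predU1P[->|ys]; rewrite ?eqxx // => xy.
- by rewrite zs.
- by rewrite zs ?orbT.
- exact: IHs.
Qed.

Definition position (R : realType) (pts : seq (Z * Z)) (z : nat) : R * R :=
  plane_point R (nth (0, 0)%binZ pts z).

Lemma position_inj (R : realType) (pts : seq (Z * Z)) (x y : 'I_(size pts)) :
  uniq pts -> position R pts x = position R pts y -> x = y.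
Proof.
move=> uniq_pts [] /real_of_Z_inj h1 /real_of_Z_inj h2.
have /eqP : nth (0, 0)%binZ pts x = nth (0, 0)%binZ pts y.
  by move: h1 h2; case: (nth _ _ x) (nth _ _ y) => [a b] [c d] /= -> ->.
by rewrite (nth_uniq _ (ltn_ord x) (ltn_ord y) uniq_pts) => /eqP /val_inj.
Qed.

Lemma vertex_off_edge (R : realType) (pts : seq (Z * Z)) (A : seq arc)
    (x y z : 'I_(size pts)) :
  drawing_ok pts (map fst A) -> arc_edge A x y -> z != x -> z != y ->
  orientation (position R pts x) (position R pts y) (position R pts z) != 0.
Proof.
move=> ok.
have arc_off (u v : 'I_(size pts)) : arc_rel A u v -> z != u -> z != v ->
    orientation (position R pts u) (position R pts v) (position R pts z) != 0.
  move=> uv zu zv; case/and3P: ok => _ /allP /(_ _ uv) /allP /(_ (val z)).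
  rewrite mem_iota /= add0n => /(_ (ltn_ord z)).
  rewrite /off_line /= !(inj_eq val_inj) (negbTE zu) (negbTE zv) /=.
  rewrite orientation_plane_point => h _; apply: contra h => /eqP h0.
  by apply/Z.eqb_eq; exact: (real_of_Z_inj (x2 := 0%binZ) h0).
case/andP=> _ /orP[xy|yx] zx zy; first exact: arc_off.
have := arc_off _ _ yx zy zx.
by apply: contra_neq => h; rewrite -[RHS]oppr0 -h /orientation; ring.
Qed.

Lemma edges_disjoint (R : realType) (pts : seq (Z * Z)) (A : seq arc)
    (x y u v : 'I_(size pts)) :
  drawing_ok pts (map fst A) -> arc_edge A x y -> arc_edge A u v ->
  u != x -> u != y -> v != x -> v != y ->
  segment (position R pts x) (position R pts y) `&`
  segment (position R pts u) (position R pts v) `<=` set0.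
Proof.
pose pt (z : nat) := nth (0, 0)%binZ pts z; pose pos := position R pts.
move=> ok + + ux uy vx vy.
have sep (a b c d : nat) : separated (pt a) (pt b) (pt c) (pt d) ->
    segment (pos a) (pos b) `&` segment (pos c) (pos d) `<=` set0.
  move=> /(real_of_Z_gt0 R) abcd w [abw cdw].
  apply: (segments_disjoint _ abw cdw).
  by rewrite !orientation_plane_point; move: abcd; rewrite /real_of_Z !rmorphM.
have clr (a b c d : 'I_(size pts)) : arc_rel A a b -> arc_rel A c d ->
    a != c -> a != d -> b != c -> b != d ->
    segment (pos a) (pos b) `&` segment (pos c) (pos d) `<=` set0.
  move=> ab cd ac ad bc bd.
  have orr e f : clear_of pts e f ->
     [|| e.1 == f.1, e.1 == f.2, e.2 == f.1 | e.2 == f.2] = false ->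
     separated (pt e.1) (pt e.2) (pt f.1) (pt f.2) \/
     separated (pt f.1) (pt f.2) (pt e.1) (pt e.2).
    rewrite /clear_of; case: ifP => [|_]; first by left.
    by case: ifP => [|_ -> //]; right.
  case/and3P: ok => _ _ /(pairwise_or) /(_ ab) /(_ cd).
  rewrite xpair_eqE !(inj_eq val_inj) (negbTE ac) /= => /(_ isT).
  case/orP => /orr; rewrite /= !(inj_eq val_inj).
    rewrite (negbTE ac) (negbTE ad) (negbTE bc) (negbTE bd).
    by case=> // /sep //; rewrite setIC.
  rewrite ![_ == a]eq_sym ![_ == b]eq_sym.
  rewrite (negbTE ac) (negbTE ad) (negbTE bc) (negbTE bd).
  by case=> // /sep //; rewrite setIC.
case/andP=> _ /orP[] xy /andP[_ /orP[] uv].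
- by apply: clr; rewrite // eq_sym.
- by rewrite (segmentC (pos u)); apply: clr; rewrite // eq_sym.
- by rewrite (segmentC (pos x)); apply: clr; rewrite // eq_sym.
- by rewrite (segmentC (pos x)) (segmentC (pos u)); apply: clr;
    rewrite // eq_sym.
Qed.

Lemma straight_line_planar (R : realType) (pts : seq (Z * Z)) (A : seq arc) :
  drawing_ok pts (map fst A) -> planar R (arc_graph (size pts) A).
Proof.
move=> ok; pose G := arc_graph (size pts) A.
pose pos (x : G) : R * R := position R pts (val x).
have /and3P[uniq_pts _ _] := ok.
have off (x y z : G) : @edge G x y -> z != x -> z != y ->
  orientation (pos x) (pos y) (pos z) != 0 by exact: vertex_off_edge.
exists pos, (fun x y => segment (pos x) (pos y)); split.
- by move=> x y /(position_inj uniq_pts).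
- by move=> x y _; exact: segmentC.
- move=> x y /andP[xy _]; apply: segment_is_arc.
  by move/(position_inj uniq_pts)/eqP; rewrite (negbTE xy).
- move=> x y z xy /orientation_segment xyz.
  have [->|zx] := eqVneq z x; first by left.
  have [->|zy] := eqVneq z y; first by right.
  by have := off _ _ _ xy zx zy; rewrite xyz eqxx.
- have fan (x y v : G) : @edge G x y -> @edge G x v -> v != y ->
      segment (pos x) (pos y) `&` segment (pos x) (pos v) `<=` range pos.
    move=> xy /andP[xv _] vy w [wxy wxv]; exists x => //; symmetry.
    by apply: (segments_fan (off _ _ _ xy _ vy) wxy wxv); rewrite eq_sym.
  move=> x y u v xy uv ne1 ne2.
  have yx : @edge G y x by rewrite edge_sym.
  have vu : @edge G v u by rewrite edge_sym.
  have [ux|ux] := eqVneq u x.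
    subst u; apply: fan => //; apply/eqP => vy; apply: ne1; congruence.
  have [uy|uy] := eqVneq u y.
    subst u; rewrite (segmentC (pos x)); apply: fan => //.
    apply/eqP => vx; apply: ne2; congruence.
  have [vx|vx] := eqVneq v x.
    by subst v; rewrite (segmentC (pos u)); apply: fan.
  have [vy|vy] := eqVneq v y.
    by subst v; rewrite (segmentC (pos u)) (segmentC (pos x)); apply: fan.
  by move=> w /(edges_disjoint ok xy uv ux uy vx vy).
Qed.

(** * Exhaustive search for colourings *)

(** A permutation of the colours is given by the word [r] of its values. *)
Definition relabel (r : seq nat) (b : bool) (c : nat) : nat :=
  if b then nth 0%N r c else c.

Definition arc_sat (r : seq nat) (f : nat -> nat) (a : arc) : bool :=
  relabel r a.2 (f a.1.1) != f a.1.2.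

Definition arcs_sat (r : seq nat) (A : seq arc) (f : nat -> nat) : bool :=
  all (arc_sat r f) A.

Definition prefix_ok (r : seq nat) (A : seq arc) (c : seq nat) : bool :=
  all (fun a : arc => if (a.1.1 < size c)%N then
                        if (a.1.2 < size c)%N then arc_sat r (nth 0%N c) a
                        else true
                      else true) A.

(** The word [c] lists the colours of the vertices [0], [1], ...; a branch of
    the search is cut off as soon as an arc between coloured vertices is
    violated. *)
Fixpoint every_extension (r : seq nat) (A : seq arc) (P : pred (seq nat))
    (k : nat) (c : seq nat) : bool :=
  if k is k'.+1 then
    all (fun x => let c' := rcons c x in
                  if prefix_ok r A c' then every_extension r A P k' c'
                  else true) (iota 0 4)
  else P c.

Lemma every_extensionP (r : seq nat) (A : seq arc) (P : pred (seq nat))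
    (f : nat -> nat) (k i : nat) :
  (forall v, f v < 4)%N -> arcs_sat r A f ->
  every_extension r A P k (mkseq f i) -> P (mkseq f (i + k)).
Proof.
move=> f4 Af; elim: k i => [|k IHk] i; first by rewrite addn0.
move=> ext; have := allP (ext : all _ (iota 0 4)) (f i).
rewrite mem_iota add0n f4 => /(_ isT) /=; rewrite -mkseqS.
case: ifP => [_|/negP[]].
  by move=> /IHk; rewrite addSnnS.
apply/allP => a aA; rewrite size_mkseq; case: ifP => // a1; case: ifP => // a2.
by rewrite /arc_sat !nth_mkseq //; exact: (allP Af _ aA).
Qed.

(** * Non-colourability up to conjugation *)

Lemma uniq_map_inj (T U : eqType) (f : T -> U) (s : seq T) :
  uniq (map f s) -> {in s &, injective f}.
Proof.
elim: s => // z s IHs /= /andP[fz fs] x y; rewrite !inE.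
case/predU1P=> [->|xs] /predU1P[->|ys] // fxy; last exact: IHs.
- by move: fz; rewrite fxy map_f.
- by move: fz; rewrite -fxy map_f.
Qed.

(** If [code] conjugates [sg] to the word [r], it turns a proper colouring of
    the labelling by [1] and [sg] into a solution of the constraints of [r]. *)
Lemma not_colourable (S : {set 'S_4}) (sg : 'S_4) (r : seq nat)
    (code : 'I_4 -> nat) (n : nat) (A : seq arc) :
  1%g \in S -> sg \in S ->
  (forall c, code c < 4)%N -> injective code ->
  (forall c, code (sg c) = nth 0%N r (code c)) ->
  simple_arcs A -> all (fun a : arc => (a.1.1 < n) && (a.1.2 < n))%N A ->
  (forall f, (forall v, f v < 4)%N -> ~~ arcs_sat r A f) ->
  ~ colourable S (arc_graph n A).
Proof.
move=> S1 Ssg code4 code_inj codeE /andP[uniqA /allP antiA] /allP boundA unsat.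
move=> col; pose D : rel (arc_graph n A) := arc_rel A.
pose sigma (x y : arc_graph n A) : 'S_4 :=
  if (val x, val y, true) \in A then sg else 1%g.
have anti (x y : 'I_n) : arc_rel A x y -> arc_rel A y x = false.
  by case/mapP=> a aA xyE; apply/negbTE; move: (antiA a aA); rewrite -xyE.
have loopless (x y : 'I_n) : arc_rel A x y -> x != y.
  by move=> xy; apply/eqP => yx; move: (anti _ _ xy); rewrite -yx {2}yx xy.
have lab : is_labeling S D sigma.
  split; last by move=> x y _; rewrite /sigma; case: ifP.
  split=> x y; first by rewrite /D /= /arc_edge => xy; rewrite loopless // xy.
  rewrite /= /arc_edge /D => /andP[_ /orP[] xy]; first by rewrite xy anti.
  by rewrite xy anti.
have [f fP] := col D sigma lab.
pose g (v : nat) := oapp (fun x : 'I_n => code (f x)) 0%N (insub v).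
have g4 v : (g v < 4)%N by rewrite /g; case: insub => //=.
have /negP := unsat g g4; apply; apply/allP => -[[u v] b] aA.
have /andP[/= un vn] := boundA _ aA.
rewrite /arc_sat /g !insubT /=; apply/eqP => h.
have uvA : D (Ordinal un) (Ordinal vn) by apply/mapP; exists (u, v, b).
apply: (fP _ _ uvA); apply: code_inj; rewrite -h /sigma /=.
case: ifP => [tA|/negP tA].
  have -> : b = true.
    have: (u, v, b) = (u, v, true).
      exact: (uniq_map_inj uniqA aA tA (erefl (u, v))).
    by case.
  by rewrite codeE.
by case: b aA tA {h} => [-> //|_ _]; rewrite perm1.
Qed.

Definition normal_words : seq (seq nat) :=
  [:: [:: 1; 0; 2; 3]; [:: 1; 0; 3; 2]; [:: 1; 2; 0; 3]; [:: 1; 2; 3; 0]]%N.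

Lemma normal_form (sg : 'S_4) : sg <> 1%g ->
  exists2 r, r \in normal_words & exists code : 'I_4 -> nat,
    [/\ forall c, (code c < 4)%N, injective code &
        forall c, code (sg c) = nth 0%N r (code c)].
Proof.
move=> sg1; pose w : seq nat := [seq val (sg c) | c <- enum 'I_4].
have wE (c : 'I_4) : nth 0%N w c = sg c.
  by rewrite (nth_map ord0) ?size_enum_ord ?nth_ord_enum.
have w_perm : w \in permutations (iota 0 4).
  rewrite mem_permutations -val_enum_ord /w (map_comp val sg); apply: perm_map.
  apply: uniq_perm; rewrite ?enum_uniq ?(map_inj_uniq perm_inj) ?enum_uniq //.
  by move=> c; rewrite mem_enum; apply/mapP; exists (sg^-1 c)%g;
    rewrite ?mem_enum ?permKV.
have wN1 : w != iota 0 4.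
  apply/eqP => w1; apply: sg1; apply/permP => c; apply: val_inj.
  by rewrite perm1 /= -wE w1 nth_iota // add0n.
pose conj_word (u r e : seq nat) := all (fun c =>
  nth 0%N e (nth 0%N u c) == nth 0%N r (nth 0%N e c)) (iota 0 4).
have /allP/(_ w w_perm)/implyP/(_ wN1) : all (fun u => (u != iota 0 4) ==>
    has (fun r => has (conj_word u r) (permutations (iota 0 4))) normal_words)
    (permutations (iota 0 4)) by vm_compute.
case/hasP=> r rN /hasP[e]; rewrite mem_permutations => e_perm /allP conj.
have size_e : size e = 4 by rewrite (perm_size e_perm).
exists r => //; exists (nth 0%N e); split=> [c|c d /eqP|c].
- have : nth 0%N e c \in iota 0 4 by rewrite -(perm_mem e_perm) mem_nth ?size_e.
  by rewrite mem_iota.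
- by rewrite nth_uniq ?size_e // ?(perm_uniq e_perm) // => /eqP/val_inj.
- by have := conj c; rewrite mem_iota /= add0n ltn_ord wE => /(_ isT) /eqP.
Qed.

(** * Frames filled with gadgets *)

(** Faces [0 1 2], [4 0 1] and [1 4 5] received the vertices [4], [5] and [6],
    so the colours of [4], [5], [6] are those of [3], [2], [0]. *)
Definition frame : seq arc :=
  [seq (e, false) | e <- [::
   (0, 1); (0, 2); (0, 3); (1, 2); (1, 3); (2, 3); (0, 4); (1, 4); (2, 4);
   (0, 5); (1, 5); (4, 5); (1, 6); (4, 6); (5, 6)]]%N.

Definition frame_points : seq (Z * Z) :=
  [:: (0, 0); (18, 11); (40, 0); (12, 40); (19, 6); (10, 5); (15, 7)]%binZ.

(** In [pattern], the corners are [0], [1], [2] and the inner vertices are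
    [3], ..., [inner + 2].  A slot lists the vertices of the frame at which the
    corners of one copy are put.  The inner vertices of a copy are drawn at
    barycentric coordinates [weights], which add up to [scale]; the frame is
    enlarged by the factor [scale] to make all points integral.  The weights
    of the designs below come from rounding Tutte embeddings. *)
Record design := Design {
  inner : nat;
  pattern : seq arc;
  slots : seq (nat * nat * nat);
  scale : Z;
  weights : seq (Z * Z * Z) }.

(** The default value of [nth] numbers the inner vertices of the [i]-th copy,
    after the 7 vertices of the frame and the inner vertices of earlier
    copies. *)
Definition place (d : design) (i : nat) (t : nat * nat * nat) (j : nat) : nat :=
  nth (7 + inner d * i + (j - 3))%N [:: t.1.1; t.1.2; t.2] j.

Definition move_arc (g : nat -> nat) (a : arc) : arc := (g a.1.1, g a.1.2, a.2).

Definition filled_frame (d : design) : seq arc :=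
  frame ++ flatten [seq [seq move_arc (place d it.1 it.2) a | a <- pattern d]
                   | it <- zip (iota 0 (size (slots d))) (slots d)].

Definition barycentre (t : nat * nat * nat) (w : Z * Z * Z) : Z * Z :=
  let corner := nth (0, 0)%binZ frame_points in
  let p := corner t.1.1 in let q := corner t.1.2 in let r := corner t.2 in
  (w.1.1 * p.1 + w.1.2 * q.1 + w.2 * r.1,
   w.1.1 * p.2 + w.1.2 * q.2 + w.2 * r.2)%binZ.

Definition points (d : design) : seq (Z * Z) :=
  [seq (scale d * p.1, scale d * p.2)%binZ | p <- frame_points] ++
  flatten [seq [seq barycentre t w | w <- weights d] | t <- slots d].

Definition well_formed (d : design) : bool :=
  let n := size (points d) in
  [&& all (fun t => [&& t.1.1 < 7, t.1.2 < 7 & t.2 < 7])%N (slots d),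
      simple_arcs (filled_frame d),
      all (fun a : arc => (a.1.1 < n) && (a.1.2 < n))%N (filled_frame d) &
      drawing_ok (points d) (map fst (filled_frame d))].

Definition uncolourable (r : seq nat) (d : design)
    (blocked : seq (nat * nat * nat)) : bool :=
  all (fun t => every_extension r (pattern d) pred0 (inner d)
                  [:: t.1.1; t.1.2; t.2]) blocked &&
  every_extension r frame
    (fun c => has (fun t => (nth 0 c t.1.1, nth 0 c t.1.2, nth 0 c t.2)%N
                              \in blocked) (slots d)) 7 [::].

(** A colouring of the filled frame colours the frame, hence puts a blocked
    triple on the corners of some slot; composed with the placement of the
    gadget in this slot, it is a colouring of the gadget, which is impossible. *)
Lemma uncolourableP (r : seq nat) (d : design) (blocked : seq (nat * nat * nat))
    (f : nat -> nat) :
  all (fun t => [&& t.1.1 < 7, t.1.2 < 7 & t.2 < 7])%N (slots d) ->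
  uncolourable r d blocked -> (forall v, f v < 4)%N ->
  ~~ arcs_sat r (filled_frame d) f.
Proof.
move=> /allP slots7 /andP[/allP block unc] f4; apply/negP.
rewrite /arcs_sat all_cat => /andP[fframe fcopies].
have /hasP[t ts] := every_extensionP f4 fframe (i := 0) unc.
have /and3P[t1 t2 t3] := slots7 _ ts.
rewrite add0n !nth_mkseq // => /block.
have [i it] : exists i, (i, t) \in zip (iota 0 (size (slots d))) (slots d).
  pose z := (0, 0, 0)%N; pose k := index t (slots d); exists k.
  have kt : (k < size (slots d))%N by rewrite index_mem.
  have -> : (k, t) = nth (0%N, z) (zip (iota 0 (size (slots d))) (slots d)) k.
    by rewrite nth_zip ?size_iota // nth_iota // nth_index.
  by rewrite mem_nth // size_zip size_iota minnn.
have copy : arcs_sat r (pattern d) (f \o place d i t).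
  apply/allP => a aA; apply: (allP fcopies (move_arc (place d i t) a)).
  apply/flattenP; exists [seq move_arc (place d i t) a | a <- pattern d].
    by apply/mapP; exists (i, t).
  exact: map_f.
by move=> /(every_extensionP (i := 3) (fun v => f4 (place d i t v)) copy).
Qed.

Lemma design_counterexample (R : realType) (S : {set 'S_4}) (sg : 'S_4)
    (r : seq nat) (code : 'I_4 -> nat) (d : design)
    (blocked : seq (nat * nat * nat)) :
  1%g \in S -> sg \in S ->
  (forall c, code c < 4)%N -> injective code ->
  (forall c, code (sg c) = nth 0%N r (code c)) ->
  well_formed d -> uncolourable r d blocked ->
  exists G : sgraph, planar R G /\ ~ colourable S G.
Proof.
move=> S1 Ssg code4 code_inj codeE /and4P[slots7 simple bound ok] unc.
exists (arc_graph (size (points d)) (filled_frame d)); split.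
  exact: straight_line_planar.
apply: (not_colourable S1 Ssg code4 code_inj codeE simple bound) => f f4.
exact: uncolourableP slots7 unc f4.
Qed.

(** * The counterexamples *)

(** The octahedra fill the faces [1 3 5] and [6 7 9] of a triangulation that was
    found by simulated annealing; their inner vertices are [10 11 12] and
    [15 16 17]. *)
Definition involution_design : design := Design 15
  ([seq (e, false) | e <- [::
   (0, 4); (0, 8); (0, 9); (1, 3); (1, 5); (1, 8); (1, 10); (1, 11); (2, 3);
   (3, 6); (3, 10); (3, 12); (3, 13); (4, 9); (5, 7); (5, 11); (6, 13);
   (6, 16); (7, 17); (9, 14); (9, 15); (10, 11); (10, 12); (11, 12); (15, 16);
   (15, 17); (16, 17)]] ++
  [seq (e, true) | e <- [::
   (0, 7); (0, 14); (2, 4); (3, 4); (3, 5); (4, 6); (4, 14); (5, 6); (5, 8);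
   (5, 12); (5, 13); (6, 7); (6, 9); (6, 17); (7, 8); (7, 9); (7, 15); (9, 16)]])%N
  [::
   (2, 4, 0); (4, 1, 2); (6, 5, 4); (1, 6, 5); (1, 2, 3); (4, 0, 5)]%N
  150%binZ
  [::
   (31, 58, 61); (60, 22, 68); (42, 84, 24); (63, 45, 42); (93, 41, 16);
   (69, 70, 11); (94, 29, 27); (21, 95, 34); (18, 110, 22); (29, 73, 48);
   (39, 61, 50); (85, 19, 46); (90, 37, 23); (86, 37, 27); (86, 39, 25)]%binZ.

Definition three_cycle_design : design := Design 3
  ([seq (e, false) | e <- [::
   (0, 3); (1, 3); (1, 4); (2, 4); (2, 5); (0, 5)]] ++
  [seq (e, true) | e <- [::
   (3, 4); (4, 5); (5, 3)]])%N
  [::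
   (4, 5, 6); (1, 3, 0); (1, 5, 0); (2, 4, 1); (1, 6, 5); (5, 4, 0);
   (1, 3, 2); (1, 6, 4)]%N
  7%binZ
  [::
   (3, 2, 2); (1, 2, 4); (1, 1, 5)]%binZ.

Definition four_cycle_design : design := Design 3
  ([seq (e, false) | e <- [::
   (0, 3); (1, 3); (1, 4); (2, 4); (2, 5); (4, 5)]] ++
  [seq (e, true) | e <- [::
   (0, 5); (3, 4); (3, 5)]])%N
  [::
   (4, 5, 6); (1, 3, 0); (1, 5, 0); (2, 4, 1); (1, 6, 5); (5, 4, 0);
   (1, 3, 2); (1, 6, 4)]%N
  7%binZ
  [::
   (3, 2, 2); (1, 2, 4); (1, 1, 5)]%binZ.

Lemma involution_design_wf : well_formed involution_design.
Proof. by vm_cast_no_check (erefl true). Qed.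

Lemma three_cycle_design_wf : well_formed three_cycle_design.
Proof. by vm_cast_no_check (erefl true). Qed.

Lemma four_cycle_design_wf : well_formed four_cycle_design.
Proof. by vm_cast_no_check (erefl true). Qed.

Theorem theorem7 (R : realType) (S : {set 'S_4})
    (idS : 1%g \in S) (S_neq_id : S <> [set 1%g]%SET) :
  bad R S /\ exists G : sgraph, planar R G /\ ~ colourable S G.
Proof.
have counterexample : exists G : sgraph, planar R G /\ ~ colourable S G.
  have [sg Ssg sg1] : exists2 sg, sg \in S & sg <> 1%g.
    apply: contra_notP S_neq_id => no_sg; apply/setP => sg; rewrite inE.
    have [->//|/eqP sg1] := eqVneq sg 1%g.
    by apply/negP => Ssg; apply: no_sg; exists sg.
  have [r rN [code [code4 code_inj codeE]]] := normal_form sg1.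
  have by_design := design_counterexample R idS Ssg code4 code_inj codeE.
  (* In each case the blocked triples are the images of (0, 1, 2) under the
     centralizer of the permutation, which acts on the colourings of a gadget
     by renaming colours. *)
  move: rN by_design {codeE}; rewrite !inE => /or4P[] /eqP-> by_design.
  - apply: (by_design _ [:: (0, 1, 2); (0, 1, 3); (1, 0, 2); (1, 0, 3)]%N
      involution_design_wf); by vm_compute.
  - apply: (by_design _ [:: (0, 1, 2); (0, 1, 3); (1, 0, 2); (1, 0, 3);
        (2, 3, 0); (2, 3, 1); (3, 2, 0); (3, 2, 1)]%N
      involution_design_wf); by vm_compute.
  - apply: (by_design _ [:: (0, 1, 2); (1, 2, 0); (2, 0, 1)]%N
      three_cycle_design_wf); by vm_compute.
  - apply: (by_design _ [:: (0, 1, 2); (1, 2, 3); (2, 3, 0); (3, 0, 1)]%N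
      four_cycle_design_wf); by vm_compute.
split=> //; have [G [planarG not_colG]] := counterexample.
split; first by move=> S0; move: idS; rewrite S0 inE.
by case=> _ /(_ G planarG).
Qed.
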